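(* Let $A$ be a symmetric algebra over a field $K$, with Frobenius comultiplication $\delta$. Let $D$ be the left $A^e$-submodule of $A\otimes A$ generated by $T(\delta(1_A))$, and let $\delta(A)\subseteq A\otimes A$ be the image of $\delta$. Then $D$ and $\delta(A)$ are the same left $A^e$-module (i.e. the same submodule of $A\otimes A$).
   Context: All tensor products are over $K$. Algebras are finite-dimensional over $K$ and unital, not necessarily commutative. $A$ is a Frobenius algebra if it is equipped with an isomorphism of left $A$-modules $\lambda_L\colon A\to A^*$, where $(a\cdot\zeta)(b):=\zeta(ba)$ for $a,b\in A$, $\zeta\in A^*$. Put $\epsilon:=\lambda_L(1_A)\colon A\to K$. The Frobenius comultiplication is $\delta:=(\lambda_L^{-1}\otimes\lambda_L^{-1})\circ\mu_T^*\circ\lambda_L\colon A\to A\otimes A$, where $\mu_T(a\otimes b)=ba$ and $(A\otimes A)^*$ is identified with $A^*\otimes A^*$. It is the coassociative comultiplication with counit $\epsilon$ that is a map of left $A^e$-modules. $A^e:=A\otimes A^{\mathrm{op}}$ acts on $A$ by $(b\otimes b')\cdot a=bab'$ and on $A\otimes A$ by $(b\otimes b')\cdot(x\otimes y)=bx\otimes yb'$. $T\colon A\otimes A\to A\otimes A$ is the involution $T(x\otimes y)=y\otimes x$. A symmetric algebra is a Frobenius algebra whose bilinear form $\eta(a\otimes b):=\lambda_L(1_A)(ab)$ satisfies $\eta\circ T=\eta$; $\delta$ is the comultiplication of this Frobenius structure. *)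

(* Defs.v *)
From HB Require Import structures.
From mathcomp Require Import all_boot all_algebra falgebra.

Set Implicit Arguments.
Unset Strict Implicit.
Unset Printing Implicit Defensive.

Import GRing.Theory.
Local Open Scope ring_scope.

Reserved Notation "x \ox y" (at level 40, left associativity).
Reserved Notation "x ** y" (at level 40, left associativity).

(* [falgType] would exclude the zero algebra: it is a [nzRingType], in which
   1 != 0.  The library has no join of [vectType] and [pzRingType], hence this
   structure; [fdalg_of_falg] below embeds [falgType] in it. *)
HB.mixin Record Vector_isFdAlgebra (K : fieldType) A of Vector K A := {
  alg_one : A;
  alg_mul : A -> A -> A;
  alg_mulA : associative alg_mul;
  alg_mul1l : left_id alg_one alg_mul;
  alg_mul1r : right_id alg_one alg_mul;
  alg_mulPl : forall y, linear (alg_mul^~ y);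
  alg_mulPr : forall x, linear (alg_mul x)
}.

#[short(type="fdAlgType")]
HB.structure Definition FdAlgebra (K : fieldType) :=
  { A of Vector K A & Vector_isFdAlgebra K A }.

Arguments alg_one {K} A : rename.
Notation "x ** y" := (alg_mul x y) : ring_scope.

Section FalgType.
Variables (K : fieldType) (A : falgType K).

Fact falg_mulPl (y : A) : linear ( *%R^~ y : A -> A).
Proof. by move=> k u v; rewrite mulrDl scalerAl. Qed.

Fact falg_mulPr (x : A) : linear ( *%R x : A -> A).
Proof. by move=> k u v; rewrite mulrDr scalerAr. Qed.

Definition fdalg_of_falg : fdAlgType K :=
  HB.pack (Falgebra.sort A)
    (Vector_isFdAlgebra.Build K (Falgebra.sort A)
       (@mulrA A) (@mul1r A) (@mulr1 A) falg_mulPl falg_mulPr).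
End FalgType.

(* The ring underlying an algebra.  It is a separate type because declaring it
   on [A] itself would be a non-forgetful inheritance. *)
Definition fdring (K : fieldType) (A : fdAlgType K) : Type := A.

Section Ring.
Variables (K : fieldType) (A : fdAlgType K).

Fact alg_mulDl : left_distributive (@alg_mul K A) +%R.
Proof. by move=> x y z; have := alg_mulPl z 1 x y; rewrite !scale1r. Qed.

Fact alg_mulDr : right_distributive (@alg_mul K A) +%R.
Proof. by move=> z x y; have := alg_mulPr z 1 x y; rewrite !scale1r. Qed.

HB.instance Definition _ := GRing.Zmodule.copy (fdring A) A.
HB.instance Definition _ := GRing.Zmodule_isPzRing.Build (fdring A)
  alg_mulA alg_mul1l alg_mul1r alg_mulDl alg_mulDr.
End Ring.

Definition alg_op (K : fieldType) (A : fdAlgType K) : Type := A.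

Section Opposite.
Variables (K : fieldType) (A : fdAlgType K).

HB.instance Definition _ := Vector.copy (alg_op A) A.

Definition op_mul (x y : alg_op A) : alg_op A := (y : A) ** (x : A).

Fact op_mulA : associative op_mul.
Proof. by move=> x y z; rewrite /op_mul alg_mulA. Qed.

HB.instance Definition _ := Vector_isFdAlgebra.Build K (alg_op A)
  op_mulA (@alg_mul1r K A) (@alg_mul1l K A) (@alg_mulPr K A) (@alg_mulPl K A).
End Opposite.

(* An element of [tensor U V] is its matrix of coordinates with respect to the
   bases [vbasis {:U}] and [vbasis {:V}].  [tens_bilinear], [tens_liftE] and [tens_ext]
   are the universal property; all maps below are defined by [tens_lift], i.e.
   by their values on pure tensors. *)
Definition tensor (K : fieldType) (U V : vectType K) : Type :=
  'M[K]_(\dim {:U}, \dim {:V}).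

HB.instance Definition _ (K : fieldType) (U V : vectType K) :=
  Vector.copy (tensor U V) 'M[K]_(\dim {:U}, \dim {:V}).

Definition tens (K : fieldType) (U V : vectType K) (u : U) (v : V) :
  tensor U V :=
  \matrix_(i, j) (coord (vbasis {:U}) i u * coord (vbasis {:V}) j v).

Notation "x \ox y" := (tens x y) : ring_scope.

Definition bilin (K : fieldType) (U V W : lmodType K) (f : U -> V -> W) :=
  (forall v, linear (f^~ v)) /\ (forall u, linear (f u)).

(* The linear map with [u \ox v |-> f u v], for bilinear [f]. *)
Definition tens_lift (K : fieldType) (U V : vectType K) (W : lmodType K)
    (f : U -> V -> W) (t : tensor U V) : W :=
  \sum_i \sum_j (t : 'M_(_, _)) i j *:
    f (vbasis {:U})`_i (vbasis {:V})`_j.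

Section TensorTheory.
Variables (K : fieldType) (U V : vectType K).

Lemma tens_bilinear : bilin (@tens K U V).
Proof.
split=> [v k x y|u k x y]; apply/matrixP=> i j; rewrite !mxE linearP.
  by rewrite mulrDl mulrA.
by rewrite mulrDr mulrCA.
Qed.

Lemma tens_basis (t : tensor U V) :
  t = \sum_i \sum_j (t : 'M_(_, _)) i j *:
    ((vbasis {:U})`_i \ox (vbasis {:V})`_j : tensor U V).
Proof.
rewrite {1}[t]matrix_sum_delta; apply: eq_bigr => i _; apply: eq_bigr => j _.
congr (_ *: _); apply/matrixP=> i' j'.
by rewrite !mxE !coord_free ?(basis_free (vbasisP _)) // -natrM mulnb eq_sym [j == _]eq_sym.
Qed.

Fact tens_lift_is_linear (W : lmodType K) (f : U -> V -> W) :
  linear (tens_lift f).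
Proof.
move=> k s t; rewrite /tens_lift scaler_sumr -big_split; apply: eq_bigr => i _.
rewrite scaler_sumr -big_split; apply: eq_bigr => j _ /=.
by rewrite !mxE scalerDl scalerA.
Qed.

HB.instance Definition _ (W : lmodType K) (f : U -> V -> W) :=
  GRing.isLinear.Build K (tensor U V) W _ (tens_lift f)
    (tens_lift_is_linear f).

Lemma bilin_sum (W : lmodType K) (f : U -> V -> W) :
  bilin f -> forall I J (r : seq I) (s : seq J) (a : I -> K) (b : J -> K) x y,
  f (\sum_(i <- r) a i *: x i) (\sum_(j <- s) b j *: y j) =
  \sum_(i <- r) \sum_(j <- s) (a i * b j) *: f (x i) (y j).
Proof.
move=> [fl fr] I J r s a b x y.
have f0l v : f 0 v = 0.
  by have := fl v (-1) 0 0; rewrite !scaleN1r oppr0 addr0 addNr.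
have f0r u : f u 0 = 0.
  by have := fr u (-1) 0 0; rewrite !scaleN1r oppr0 addr0 addNr.
elim: r => [|i r IHr]; first by rewrite !big_nil f0l.
rewrite !big_cons fl IHr; congr (_ + _).
elim: s {IHr} => [|j s IHs]; first by rewrite !big_nil f0r scaler0.
by rewrite !big_cons fr scalerDr IHs scalerA.
Qed.

Lemma tens_liftE (W : lmodType K) (f : U -> V -> W) u v :
  bilin f -> tens_lift f (u \ox v) = f u v.
Proof.
move=> bf.
rewrite [in RHS](coord_vbasis (memvf u)) [in RHS](coord_vbasis (memvf v)).
rewrite bilin_sum //; apply: eq_bigr => i _; apply: eq_bigr => j _.
by rewrite mxE.
Qed.

Lemma tens_ext (W : lmodType K) (f g : {linear tensor U V -> W}) :
  (forall u v, f (u \ox v) = g (u \ox v)) -> f =1 g.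
Proof.
move=> fg t; rewrite [t]tens_basis !linear_sum; apply: eq_bigr => i _.
by rewrite !linear_sum; apply: eq_bigr => j _; rewrite !linearZ fg.
Qed.

Lemma tens_ind (P : tensor U V -> Prop) :
  (forall k s t, P s -> P t -> P (k *: s + t)) ->
  (forall u v, P (u \ox v)) -> forall t, P t.
Proof.
move=> Plin Ppure t.
have P0 : P 0 by rewrite -(addNr (0 \ox 0)) -scaleN1r; apply: Plin.
rewrite [t]tens_basis; apply: (big_rec P) => // i s _ Ps.
rewrite -[X in X + _]scale1r; apply: (Plin) => //.
by apply: (big_rec P) => // j s' _ Ps'; apply: Plin.
Qed.

Lemma bilin_tens_lift (X Y W : lmodType K) (F : X -> Y -> U -> V -> W) t :
  (forall u v, bilin (fun x y => F x y u v)) ->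
  bilin (fun x y => tens_lift (F x y) t).
Proof.
move=> bF; split=> [y|x] k x1 x2; rewrite /tens_lift scaler_sumr -big_split;
  apply: eq_bigr => i _; rewrite scaler_sumr -big_split; apply: eq_bigr => j _;
  have [Fl Fr] := bF (vbasis {:U})`_i (vbasis {:V})`_j.
  by rewrite Fl /= scalerDr !scalerA mulrC.
by rewrite Fr /= scalerDr !scalerA mulrC.
Qed.

End TensorTheory.

Definition tens_hom (K : fieldType) (U U' V V' : vectType K)
    (f : 'Hom(U, U')) (g : 'Hom(V, V')) : 'Hom(tensor U V, tensor U' V') :=
  linfun (tens_lift (fun u v => f u \ox g v)).

Definition tens_swap (K : fieldType) (V : vectType K) :
    'Hom(tensor V V, tensor V V) :=
  linfun (tens_lift (fun x y => y \ox x)).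

Section PureTensors.
Variable K : fieldType.

Lemma bilin_tens_comp (X Y U V : vectType K) (f : X -> U) (g : Y -> V) :
  linear f -> linear g -> bilin (fun x y => f x \ox g y).
Proof.
move=> lf lg; have [tl tr] := tens_bilinear U V.
by split=> [y|x] k x1 x2; rewrite ?lf ?lg ?tl ?tr.
Qed.

Lemma tens_homE (U U' V V' : vectType K) (f : 'Hom(U, U')) (g : 'Hom(V, V'))
  u v : tens_hom f g (u \ox v) = f u \ox g v.
Proof.
by rewrite lfunE /= tens_liftE //; apply: bilin_tens_comp; apply: linearP.
Qed.

Lemma tens_swapE (V : vectType K) (x y : V) : tens_swap V (x \ox y) = y \ox x.
Proof.
have [tl tr] := tens_bilinear V V.
by rewrite lfunE /= tens_liftE //; split=> [v|u] k x1 x2; rewrite ?tl ?tr.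
Qed.

End PureTensors.

Section TensorAlgebra.
Variables (K : fieldType) (A B : fdAlgType K).

Definition tens_one : tensor A B := alg_one A \ox alg_one B.

Definition tens_mul (s t : tensor A B) : tensor A B :=
  tens_lift (fun a b => tens_lift (fun a' b' => (a ** a') \ox (b ** b')) t) s.

Fact tens_mulPl t : linear (tens_mul^~ t).
Proof. by move=> k s s'; rewrite /tens_mul linearP. Qed.

Let bilinl (a' : A) (b' : B) : bilin (fun a b => (a ** a') \ox (b ** b')).
Proof. by apply: bilin_tens_comp; apply: alg_mulPl. Qed.

Let bilinr (a : A) (b : B) : bilin (fun a' b' => (a ** a') \ox (b ** b')).
Proof. by apply: bilin_tens_comp; apply: alg_mulPr. Qed.

Lemma tens_mulE a b a' b' :
  tens_mul (a \ox b) (a' \ox b') = (a ** a') \ox (b ** b').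
Proof.
rewrite /tens_mul tens_liftE; first by rewrite tens_liftE.
exact: bilin_tens_lift.
Qed.

Fact tens_mulPr s : linear (tens_mul s).
Proof.
move=> k t t'; elim/(@tens_ind K A B): s => [l s1 s2 IH1 IH2|a b].
  rewrite !tens_mulPl IH1 IH2 !scalerDr !scalerA (mulrC k) -!addrA.
  by congr (_ + _); rewrite addrCA.
by rewrite /tens_mul !tens_liftE ?linearP //; apply: bilin_tens_lift.
Qed.

Fact tens_mulA : associative tens_mul.
Proof.
move=> r s t; elim/(@tens_ind K A B): r => [k r1 r2 IH1 IH2|a b].
  by rewrite !tens_mulPl IH1 IH2.
elim/(@tens_ind K A B): s => [k s1 s2 IH1 IH2|a' b'].
  by rewrite tens_mulPl !tens_mulPr tens_mulPl IH1 IH2.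
elim/(@tens_ind K A B): t => [k t1 t2 IH1 IH2|a'' b''].
  by rewrite !tens_mulPr IH1 IH2.
by rewrite !tens_mulE !alg_mulA.
Qed.

Fact tens_mul1l : left_id tens_one tens_mul.
Proof.
elim/(@tens_ind K A B) => [k s t IHs IHt|a b]; first by rewrite tens_mulPr IHs IHt.
by rewrite tens_mulE !alg_mul1l.
Qed.

Fact tens_mul1r : right_id tens_one tens_mul.
Proof.
elim/(@tens_ind K A B) => [k s t IHs IHt|a b]; first by rewrite tens_mulPl IHs IHt.
by rewrite tens_mulE !alg_mul1r.
Qed.

HB.instance Definition _ := Vector_isFdAlgebra.Build K (tensor A B)
  tens_mulA tens_mul1l tens_mul1r tens_mulPl tens_mulPr.
End TensorAlgebra.

Section Enveloping.
Variables (K : fieldType) (A : fdAlgType K).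

Definition env : fdAlgType K := tensor A (alg_op A).

(* [A \ox A] as a left [A^e]-module; a type of its own, since [tensor A A] is
   already a module over [K]. *)
Definition env_module : Type := tensor A A.

Definition env_act (r : fdring env) (t : env_module) : env_module :=
  tens_lift (fun (b : A) (b' : alg_op A) =>
    tens_lift (fun x y : A => (b ** x) \ox (y ** (b' : A))) t)
    (r : tensor A (alg_op A)).

Lemma env_actE (b b' x y : A) :
  env_act (b \ox (b' : alg_op A) : tensor A (alg_op A)) (x \ox y) =
  (b ** x) \ox (y ** b').
Proof. exact: (@tens_mulE K A (alg_op A)). Qed.

HB.instance Definition _ := GRing.Zmodule.copy env_module (tensor A A).

(* The action of [A^e] on [A \ox A] is convertible to the product of [A^e]. *)
Fact env_actA r s t : env_act r (env_act s t) = env_act (r * s) t.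
Proof. exact: (@alg_mulA K env). Qed.

Fact env_act1 : left_id 1 env_act.
Proof. exact: (@alg_mul1l K env). Qed.

Fact env_actDr : right_distributive env_act +%R.
Proof. exact: (@alg_mulDr K env). Qed.

Fact env_actDl t : {morph env_act^~ t : r s / r + s}.
Proof. move=> r s; exact: (@alg_mulDl K env). Qed.

HB.instance Definition _ := GRing.Zmodule_isLmodule.Build (fdring env)
  env_module env_actA env_act1 env_actDr env_actDl.
End Enveloping.

Section Submodule.
Variables (R : pzRingType) (M : lmodType R).

Definition submodule (S : M -> Prop) :=
  S 0 /\ forall r x y, S x -> S y -> S (r *: x + y).

Definition submodule_gen (t : M) : M -> Prop :=
  fun x => forall S, submodule S -> S t -> S x.

Lemma submodule_genP t x : submodule_gen t x <-> exists r, x = r *: t.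
Proof.
split=> [gx|[r ->] S [S0 SP] St]; last by rewrite -[_ *: _]addr0; apply: SP.
apply: (gx (fun y => exists r, y = r *: t)); last by exists 1; rewrite scale1r.
split=> [|r _ _ [a ->] [b ->]]; first by exists 0; rewrite scale0r.
by exists (r * a + b); rewrite scalerDl scalerA.
Qed.
End Submodule.

Notation dual V := 'Hom(V, GRing.regular _).

Definition transpose (K : fieldType) (U V : vectType K) (f : 'Hom(U, V)) :
    'Hom(dual V, dual U) :=
  linfun (fun zeta : dual V => (zeta \o f)%VF).

(* The identification of the tensor product of the duals with the dual of the
   tensor product: (zeta \ox xi) (u \ox v) = zeta u * xi v. *)
Definition dual_tens (K : fieldType) (U V : vectType K) :
    'Hom(tensor (dual U) (dual V), dual (tensor U V)) :=
  linfun (tens_lift (fun (zeta : dual U) (xi : dual V) =>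
    linfun (tens_lift (fun u v => zeta u * xi v : K^o)))).

Section DualTheory.
Variables (K : fieldType) (U V : vectType K).

Lemma linfunE (W X : vectType K) (f : W -> X) : linear f -> linfun f =1 f.
Proof.
move=> lf x; pose lfm := GRing.isLinear.Build K W X _ f lf.
by pose F : {linear W -> X} := HB.pack f lfm; apply: (lfunE F).
Qed.

Lemma transposeE (f : 'Hom(U, V)) (zeta : dual V) u :
  transpose f zeta u = zeta (f u).
Proof.
rewrite linfunE ?comp_lfunE // => k z1 z2.
by apply/lfunP=> x; rewrite !(comp_lfunE, add_lfunE, scale_lfunE).
Qed.

Let bilin_ev (zeta : dual U) (xi : dual V) :
  bilin (fun u v => zeta u * xi v : K^o).
Proof.
split=> [v|u] k x y; rewrite linearP.
  by rewrite mulrDl -scalerAl.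
by rewrite mulrDr -scalerAr.
Qed.

Let bilin_dual (u : U) (v : V) :
  bilin (fun (zeta : dual U) (xi : dual V) => zeta u * xi v : K^o).
Proof.
split=> [xi|zeta] k x y; rewrite add_lfunE scale_lfunE.
  by rewrite mulrDl -scalerAl.
by rewrite mulrDr -scalerAr.
Qed.

Let bilin_dual_tens : bilin (fun (zeta : dual U) (xi : dual V) =>
  linfun (tens_lift (fun u v => zeta u * xi v : K^o)) : dual (tensor U V)).
Proof.
split=> [xi|zeta] k x y; apply/lfunP=> t; rewrite add_lfunE scale_lfunE !lfunE;
  have [Bl Br] := bilin_tens_lift t bilin_dual.
  exact: Bl.
exact: Br.
Qed.

Lemma dual_tensE (zeta : dual U) (xi : dual V) u v :
  dual_tens U V (zeta \ox xi) (u \ox v) = zeta u * xi v.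
Proof. by rewrite lfunE /= tens_liftE // lfunE /= tens_liftE. Qed.

Lemma dual_tens_bij : bijective (dual_tens U V).
Proof.
have surj : limg (dual_tens U V) = fullv.
  apply/eqP; rewrite eqEsubv subvf; apply/subvP=> phi' _.
  pose phi : dual (tensor U V) := phi'; rewrite -[phi']/phi.
  pose c (W : vectType K) i : dual W := linfun (coord (vbasis {:W}) i : W -> K^o).
  pose s : tensor (dual U) (dual V) := \sum_(i < \dim {:U}) \sum_(j < \dim {:V})
    phi ((vbasis {:U})`_i \ox (vbasis {:V})`_j) *: (c U i \ox c V j).
  suff -> : phi = dual_tens U V s by apply: memv_img (memvf _).
  suff E u v : phi (u \ox v) = dual_tens U V s (u \ox v).
    by apply/lfunP; apply: tens_ext => u v; apply: E.
  have -> : dual_tens U V s = \sum_(i < \dim {:U}) \sum_(j < \dim {:V})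
      phi ((vbasis {:U})`_i \ox (vbasis {:V})`_j) *:
      dual_tens U V (c U i \ox c V j).
    rewrite /s linear_sum; apply: eq_bigr => i _.
    by rewrite linear_sum; apply: eq_bigr => j _; rewrite linearZ.
  rewrite sum_lfunE [in LHS](coord_vbasis (memvf u)).
  rewrite [in LHS](coord_vbasis (memvf v)).
  rewrite (bilin_sum (tens_bilinear U V)) linear_sum; apply: eq_bigr => i _.
  rewrite linear_sum sum_lfunE; apply: eq_bigr => j _.
  by rewrite linearZ scale_lfunE dual_tensE !lfunE /= [RHS]mulrC.
have dimD (W : vectType K) : \dim {:dual W} = \dim {:W}.
  by rewrite !dimvf; apply: muln1.
have dimT (W W' : vectType K) :
    \dim {:tensor W W'} = (\dim {:W} * \dim {:W'})%N by rewrite dimvf.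
have inj : lker (dual_tens U V) == 0%VS.
  have /eqP := limg_ker_dim (dual_tens U V) fullv.
  rewrite surj capfv dimD !dimT !dimD -[X in _ == X]add0n eqn_add2r.
  by rewrite dimv_eq0.
exists (dual_tens U V)^-1%VF; first exact: lker0_lfunK.
by move=> phi; apply: limg_lfunVK; rewrite surj memvf.
Qed.
End DualTheory.

Section Frobenius.
Variables (K : fieldType) (A : fdAlgType K).

Definition dual_act (a : A) (zeta : dual A) : dual A :=
  linfun (fun b => zeta (b ** a)).

Lemma dual_actE a zeta b : dual_act a zeta b = zeta (b ** a).
Proof.
by rewrite linfunE // => k x y; rewrite alg_mulPl linearP.
Qed.

Record frobenius := Frobenius {
  frob_iso : 'Hom(A, dual A);
  frob_iso_bij : bijective frob_iso;
  frob_iso_act : forall a b, frob_iso (a ** b) = dual_act a (frob_iso b)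
}.

Definition mulT : 'Hom(tensor A A, A) := linfun (tens_lift (fun a b => b ** a)).

Variable L : frobenius.

Definition frob_counit : dual A := frob_iso L (alg_one A).

Definition frob_form : dual (tensor A A) :=
  linfun (tens_lift (fun a b => frob_counit (a ** b))).

Definition symmetric_frobenius := (frob_form \o tens_swap A)%VF = frob_form.

(* The inverses of [frob_iso L] and [dual_tens A A] in 'Hom are two-sided, by
   [frob_iso_bij] and [dual_tens_bij]. *)
Definition frob_comul : 'Hom(A, tensor A A) :=
  (tens_hom (frob_iso L)^-1 (frob_iso L)^-1 \o (dual_tens A A)^-1
     \o transpose mulT \o frob_iso L)%VF.
End Frobenius.

(* Main.v *)
(* Symmetry of the form gives T(delta 1) = delta 1, and delta is a map of left
   A^e-modules, so the submodule generated by delta 1 is delta(A).  Both facts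
   are checked against the nondegenerate pairing
   <u (x) v, x (x) y> = eps(x u) eps(y v), for which
   <delta a, x (x) y> = eps(y x a). *)
Require Import Defs.
From HB Require Import structures.
From mathcomp Require Import all_boot all_algebra falgebra.

Set Implicit Arguments.
Unset Strict Implicit.
Unset Printing Implicit Defensive.

Import GRing.Theory.
Local Open Scope ring_scope.

Lemma dual_tensVK (K : fieldType) (U V : vectType K) :
  cancel (dual_tens U V)^-1%VF (dual_tens U V).
Proof.
(* The inverse in 'Hom is a right inverse only on the image; surjectivity comes from the
   set-theoretic inverse [g]. *)
case: (dual_tens_bij U V) => g _ gK phi; apply: limg_lfunVK.
by rewrite -(gK phi); apply: memv_img (memvf _).
Qed.

Lemma tens_homK (K : fieldType) (U U' V V' : vectType K)
    (f : 'Hom(U, U')) (f' : 'Hom(U', U)) (g : 'Hom(V, V')) (g' : 'Hom(V', V)) :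
  cancel f f' -> cancel g g' -> cancel (tens_hom f g) (tens_hom f' g').
Proof.
move=> fK gK; elim/(@tens_ind K U V) => [k s t IHs IHt|u v].
  by rewrite !linearP /= IHs IHt.
by rewrite !tens_homE fK gK.
Qed.

Section SymmetricFrobenius.
Variables (K : fieldType) (A : fdAlgType K) (L : frobenius A).

Let eps : dual A := frob_counit L.

Lemma frob_isoE (a b : A) : frob_iso L a b = eps (b ** a).
Proof. by rewrite -[a in LHS]alg_mul1r frob_iso_act dual_actE. Qed.

Lemma frob_isoVK : cancel (frob_iso L)^-1%VF (frob_iso L).
Proof.
case: (frob_iso_bij L) => g _ gK zeta; apply: limg_lfunVK.
by rewrite -(gK zeta); apply: memv_img (memvf _).
Qed.

Lemma frob_isoK : cancel (frob_iso L) (frob_iso L)^-1%VF.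
Proof.
move=> a; have [g fK _] := frob_iso_bij L.
by apply: (can_inj fK); rewrite frob_isoVK.
Qed.

(** Built from the two maps that [frob_comul] inverts, so that pairing with a comultiplication
    cancels both inverses. *)
Definition frob_pairing (s : tensor A A) : dual (tensor A A) :=
  dual_tens A A (tens_hom (frob_iso L) (frob_iso L) s).

Lemma frob_pairingP k s t u :
  frob_pairing (k *: s + t) u = k *: frob_pairing s u + frob_pairing t u.
Proof. by rewrite /frob_pairing !linearP /= add_lfunE scale_lfunE. Qed.

Lemma frob_pairingE u v x y :
  frob_pairing (u \ox v) (x \ox y) = eps (x ** u) * eps (y ** v).
Proof.
by rewrite /frob_pairing tens_homE dual_tensE (frob_isoE u) (frob_isoE v).
Qed.

(** Nondegeneracy: [frob_pairing] is a composite of injective maps, and pure tensors span. *)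
Lemma frob_pairing_inj s t :
  (forall x y, frob_pairing s (x \ox y) = frob_pairing t (x \ox y)) -> s = t.
Proof.
move=> st; apply: (can_inj (tens_homK frob_isoK frob_isoK)).
apply: (bij_inj (dual_tens_bij A A)).
by apply/lfunP; apply: tens_ext.
Qed.

Lemma mulTE (x y : A) : mulT A (x \ox y) = y ** x.
Proof.
rewrite lfunE /= tens_liftE //; split=> [v|u] k a b; first exact: alg_mulPr.
exact: alg_mulPl.
Qed.

Lemma frob_pairing_comul a x y :
  frob_pairing (frob_comul L a) (x \ox y) = eps (y ** x ** a).
Proof.
rewrite /frob_pairing /frob_comul !comp_lfunE.
rewrite (tens_homK frob_isoVK frob_isoVK) dual_tensVK.
by rewrite transposeE mulTE frob_isoE.
Qed.

Lemma frob_pairing_swap s x y :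
  frob_pairing (tens_swap A s) (x \ox y) = frob_pairing s (y \ox x).
Proof.
elim/(@tens_ind K A A): s => [k s t IHs IHt|u v].
  by rewrite linearP /= !frob_pairingP IHs IHt.
by rewrite tens_swapE !frob_pairingE mulrC.
Qed.

Hypothesis symL : symmetric_frobenius L.

(** Evaluating the symmetry of the form on pure tensors turns it into the trace property of
    [eps]. *)
Lemma frob_counitC a b : eps (a ** b) = eps (b ** a).
Proof.
have formE x y : frob_form L (x \ox y) = eps (x ** y).
  rewrite lfunE /= tens_liftE //.
  by split=> [v|u] k c d; rewrite ?alg_mulPl ?alg_mulPr linearP.
by rewrite -!formE -[in LHS]symL comp_lfunE tens_swapE.
Qed.

(** The two sides pair with x (x) y to eps(x y) and eps(y x). *)
Lemma swap_frob_comul1 :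
  tens_swap A (frob_comul L (alg_one A)) = frob_comul L (alg_one A).
Proof.
apply: frob_pairing_inj => x y.
by rewrite frob_pairing_swap !frob_pairing_comul !alg_mul1r frob_counitC.
Qed.

(** The adjoint of the action: b passes to x by associativity, b' passes to y by the trace
    property. *)
Lemma frob_pairing_act (b b' : A) (s : tensor A A) x y :
  frob_pairing (env_act (b \ox (b' : alg_op A) : tensor A (alg_op A)) s)
    (x \ox y) = frob_pairing s ((x ** b) \ox (b' ** y)).
Proof.
elim/(@tens_ind K A A): s => [k s t IHs IHt|u v].
  (* [env_act] is convertible to the product of A^e, whose linearity applies. *)
  rewrite [env_act _ _](@tens_mulPr K A (alg_op A)).
  by rewrite !frob_pairingP IHs IHt.
rewrite env_actE !frob_pairingE alg_mulA; congr (_ * _).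
by rewrite alg_mulA frob_counitC alg_mulA.
Qed.

(** Both sides pair to eps of the same cyclic word in b', y, x, b, a. *)
Lemma frob_comul_act (b b' a : A) :
  env_act (b \ox (b' : alg_op A) : tensor A (alg_op A)) (frob_comul L a) =
  frob_comul L (b ** a ** b').
Proof.
apply: frob_pairing_inj => x y.
rewrite frob_pairing_act !frob_pairing_comul.
by rewrite -!alg_mulA frob_counitC !alg_mulA.
Qed.

End SymmetricFrobenius.

Theorem proposition4p3 (K : fieldType) (A : fdAlgType K) (L : frobenius A)
    (symL : symmetric_frobenius L) (t : env_module A) :
  submodule_gen (tens_swap A (frob_comul L (alg_one A)) : env_module A) t <->
  (t : tensor A A) \in limg (frob_comul L).
Proof.
rewrite (swap_frob_comul1 symL); apply: (iff_trans (submodule_genP _ _)).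
split=> [[r ->]|].
  rewrite -[_ *: _]/(env_act r (frob_comul L (alg_one A))).
  (* The image is a K-subspace, so pure b (x) b' suffice; these send delta 1 to delta(b b'). *)
  elim/(@tens_ind K A (alg_op A)): r => [k r s IHr IHs|b b'].
    by rewrite [env_act _ _](@tens_mulPl K A (alg_op A)) memvD ?memvZ.
  by rewrite (frob_comul_act symL) memv_img ?memvf.
case/memv_imgP=> a _ ->.
(* Left multiplication alone reaches delta a, since a (x) 1 sends delta 1 to delta(a 1 1). *)
exists (a \ox (alg_one A : alg_op A) : tensor A (alg_op A)).
by rewrite [RHS](frob_comul_act symL) !alg_mul1r.
Qed.
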